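(* Let $\mathbf u$ be a recurrent aperiodic infinite word over a finite alphabet whose language is closed under reversal. Let $n>m\ge 0$ be integers and suppose that $$\Delta p_{\mathbf u}(m)=1,\qquad \Delta p_{\mathbf u}(j)\ge 2\quad\text{for all integers } m<j\le n.$$ Assume $p_{\mathbf u}(m)\le 2m+1$ and let $$q:=p_{\mathbf u}(m)\ (\ge m+1),\qquad C_{m,q}:=\frac{3q}{m+1+q}\ \left(\ge\tfrac32\right).$$ If $$p_{\mathbf u}(n)\le C_{m,q}\,n+1,$$ then $T_{\mathbf u}(n)=0$.
   Context: Infinite words are one-sided. A factor of $\mathbf u$ is a contiguous finite block (including the empty word); the language of $\mathbf u$ is the set of its factors. The reversal of $w=w_1\cdots w_r$ is $\overline w=w_r\cdots w_1$; $w$ is a palindrome if $w=\overline w$; the language is closed under reversal if it contains $\overline w$ whenever it contains $w$. The word $\mathbf u$ is recurrent if every factor occurs infinitely often, and aperiodic if it is not of the form $xyyy\cdots$ with $x,y$ finite words and $y$ nonempty. $p_{\mathbf u}(n)$ is the number of factors of length $n$, $\operatorname{Pal}_{\mathbf u}(n)$ the number of palindromic factors of length $n$, $\Delta p_{\mathbf u}(n):=p_{\mathbf u}(n+1)-p_{\mathbf u}(n)$, and the local palindromic gap at length $n$ is $$T_{\mathbf u}(n):=\Delta p_{\mathbf u}(n)+2-\operatorname{Pal}_{\mathbf u}(n)-\operatorname{Pal}_{\mathbf u}(n+1).$$ The inequalities $q\ge m+1$ and $C_{m,q}\ge 3/2$ in parentheses hold automatically for such $\mathbf u$. *)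

(* Defs.v *)
From mathcomp Require Import all_boot all_order all_algebra.
From mathcomp Require Import boolp.

Set Implicit Arguments.
Unset Strict Implicit.
Unset Printing Implicit Defensive.

Import Order.TTheory GRing.Theory Num.Theory.

Local Open Scope ring_scope.

Section Words.

Variable A : finType.
Implicit Types (u : nat -> A) (w x y : seq A).

Definition occurs_at u w (i : nat) : Prop :=
  w = mkseq (fun k => u (i + k)%N) (size w).

Definition factor u w : Prop := exists i : nat, occurs_at u w i.

Definition palindrome w : bool := w == rev w.

Definition closed_under_reversal u : Prop :=
  forall w, factor u w -> factor u (rev w).

Definition recurrent u : Prop :=
  forall w, factor u w -> forall N : nat, exists2 i : nat, (N <= i)%N & occurs_at u w i.

(* The equality u = x y y y ... is expressed by saying that every finite word
   x y ^ k is a prefix of u; as y is nonempty, these prefixes determine u. *)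
Definition eventually_periodic u : Prop :=
  exists x y, y <> [::] /\
    forall k : nat, occurs_at u (x ++ flatten (nseq k y)) 0.

Definition aperiodic u : Prop := ~ eventually_periodic u.

Definition complexity u (n : nat) : nat :=
  #|[set w : n.-tuple A | `[< factor u w >]]|.

Definition pal_complexity u (n : nat) : nat :=
  #|[set w : n.-tuple A | `[< factor u w >] && palindrome w]|.

(* Values in int, so that no subtraction is truncated. *)
Definition delta_complexity u (n : nat) : int :=
  (complexity u n.+1)%:Z - (complexity u n)%:Z.

Definition pal_gap u (n : nat) : int :=
  delta_complexity u n + 2 - (pal_complexity u n)%:Z
    - (pal_complexity u n.+1)%:Z.

End Words.

Definition slope_bound (m q : nat) : rat := (3 * q)%N%:R / (m + 1 + q)%N%:R.

(* Main.v *)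
Require Import Defs.
From mathcomp Require Import all_boot all_order all_algebra.
From mathcomp Require Import boolp.
From mathcomp Require Import zify.

Import Order.TTheory GRing.Theory Num.Theory.

Set Implicit Arguments.
Unset Strict Implicit.
Unset Printing Implicit Defensive.

(** Write T for the palindromic gap, q for the complexity at m, and call a factor
    special when it has several right (or left) extensions.

    The slope is 1 at m and at least 2 just after.  Slope 1 means that there is a
    single right special factor w of length m, with two extensions a and b; the
    slope can only increase at the next length if w is also left special.  By
    reversal w is then a palindrome, and all of awa, awb, bwa, bwb are factors
    [full_branching_exists].  So the word is an infinite concatenation of two
    loops based at w: after an occurrence of w, the next letter alone decides
    everything up to the next occurrence of w, because no other factor of length
    m branches [agree_deterministic, return_agree].  Let ret a and ret b be the
    lengths of the loops.  Every factor of length m lies on a loop, whence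
    q + 1 <= ret a + ret b [complexity_le_returns].

    Reversal maps loops to loops.  It could exchange the two, but then both have
    the same length r with 2 r - 1 <= q <= 2 m + 1, so r <= m + 1, and a loop this
    short is determined by w or has its only free letter in its centre.  Hence
    both loops are palindromes [loop_palindrome].  The only palindromic factors of
    lengths m and m + 1 are then w and the centres of the two loops, three in
    all, which gives T(m) = 0 [pal_complexity_short].

    Passing from T(k) to T(k + 1) only involves the bispecial factors of length
    k, and their contribution vanishes when each of them is a palindrome v with
    two extensions on each side such that avb is a factor [pal_gap_step].
    For k >= m a bispecial factor starts and ends with w, so it is a sequence of
    loops.  If k < m + ret a + ret b, the two loops do not both fit in it, so it
    is a power of one loop, hence a palindrome; and by recurrence the run of this
    loop ends somewhere, which yields the mixed extension
    [stretch_palindrome, stretch_overlap, bispecial_balanced].  Thus T(n) = 0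
    for all n from m to m + 1 + q.

    It remains to see that n is in this range.  Since the slope is at least 2
    after m, the complexity at n is at least q - 1 + 2 (n - m).  The line through
    (0, 1) of slope 3 q / (m + 1 + q) < 2 meets this lower bound exactly at the
    length m + 1 + q [length_bound]. *)

(** * Windows of an infinite word *)

Section Windows.
Variables (A : finType) (u : nat -> A).
Implicit Types (v : seq A) (i j k p r t : nat).

Definition lang v : bool := `[< factor u v >].

Definition window i k : seq A := mkseq (fun t => u (i + t)) k.

(** Equality of two windows, stated letter by letter so that shifts and overlaps
    are arithmetic on positions. *)
Definition agree i j k : Prop := forall t, t < k -> u (i + t) = u (j + t).

Lemma size_window i k : size (window i k) = k.
Proof. exact: size_mkseq. Qed.

Lemma nth_window x i k t : t < k -> nth x (window i k) t = u (i + t).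
Proof. by move=> ltk; rewrite nth_mkseq. Qed.

Lemma eq_window i j k : window i k = window j k <-> agree i j k.
Proof.
split=> [eqw t ltk | eqw].
  by rewrite -(nth_window (u 0) i ltk) eqw nth_window.
apply: (@eq_from_nth _ (u 0)) => [|t]; rewrite !size_window // => ltk.
by rewrite !nth_window // eqw.
Qed.

Lemma rcons_window i k : window i k.+1 = rcons (window i k) (u (i + k)).
Proof. exact: mkseqS. Qed.

Lemma cons_window i k : window i k.+1 = u i :: window i.+1 k.
Proof.
apply: (@eq_from_nth _ (u 0)) => [|t].
  by rewrite [RHS]/= !size_window.
rewrite size_window => ltk; rewrite nth_window //; case: t ltk => [|t] ltk.
  by rewrite addn0.
by rewrite -[nth _ (_ :: _) _]/(nth _ (window _ _) _) nth_window // addnS.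
Qed.

Lemma agree_sym i j r : agree i j r -> agree j i r.
Proof. by move=> ag t ltr; rewrite ag. Qed.

Lemma agree_trans i j p r : agree i j r -> agree j p r -> agree i p r.
Proof. by move=> ag ag' t ltr; rewrite ag // ag'. Qed.

Lemma agree_le i j r r' : r <= r' -> agree i j r' -> agree i j r.
Proof. by move=> le ag t ltr; apply: ag; lia. Qed.

Lemma agree_shift i j p r : agree i j (p + r) -> agree (i + p) (j + p) r.
Proof. by move=> ag t ltr; rewrite -!addnA; apply: ag; lia. Qed.

Lemma agree_glue i j p r r' :
  p <= r -> agree i j r -> agree (i + p) (j + p) r' -> agree i j (p + r').
Proof.
move=> le ag ag' t lt; have [ltr|ler] := ltnP t r; first exact: ag.
have := ag' (t - p); rewrite -!addnA subnKC; last by lia.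
by apply; lia.
Qed.

Lemma agreeS i j r : agree i j r -> u (i + r) = u (j + r) -> agree i j r.+1.
Proof.
move=> ag eqr t; rewrite ltnS leq_eqVlt => /orP[/eqP->//|]; exact: ag.
Qed.

Lemma langP v : reflect (exists i, v = window i (size v)) (lang v).
Proof. exact: asboolP. Qed.

Lemma lang_window i k : lang (window i k).
Proof. by apply/langP; exists i; rewrite size_window. Qed.

Lemma lang_rconsP v y :
  reflect (exists i, v = window i (size v) /\ u (i + size v) = y)
          (lang (rcons v y)).
Proof.
apply: (iffP (langP _)) => -[i]; last first.
  by case=> eqv <-; exists i; rewrite size_rcons rcons_window -eqv.
by rewrite size_rcons rcons_window => /rcons_inj[eqv ->]; exists i.
Qed.

Lemma lang_consP v x :
  reflect (exists i, u i = x /\ v = window i.+1 (size v)) (lang (x :: v)).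
Proof.
apply: (iffP (langP _)) => -[i]; last first.
  by case=> <- eqv; exists i; rewrite [size _]/= cons_window -eqv.
by rewrite [size _]/= cons_window => -[-> eqv]; exists i.
Qed.

Lemma lang_belast v y : lang (rcons v y) -> lang v.
Proof. by case/lang_rconsP=> i [-> _]; apply: lang_window. Qed.

Lemma lang_behead v x : lang (x :: v) -> lang v.
Proof. by case/lang_consP=> i [_ ->]; apply: lang_window. Qed.

Lemma lang_extend v : lang v -> exists y, lang (rcons v y).
Proof.
case/langP=> i eqv; exists (u (i + size v)); apply/lang_rconsP.
by exists i.
Qed.

Lemma rev_window i k t x : t < k ->
  nth x (rev (window i k)) t = u (i + (k - t.+1)).
Proof. by move=> ltk; rewrite nth_rev size_window ?nth_window //; lia. Qed.

Hypothesis u_rev : closed_under_reversal u.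

Lemma lang_rev v : lang (rev v) = lang v.
Proof.
by apply/idP/idP=> /asboolP /u_rev /asboolP; rewrite ?revK.
Qed.

(** Closure under reversal in terms of positions; this is the form in which it
    applies to occurrences. *)
Lemma mirror i k : exists j, forall t, t < k -> u (j + t) = u (i + (k - t.+1)).
Proof.
have /langP[j] : lang (rev (window i k)) by rewrite lang_rev lang_window.
rewrite size_rev size_window => eqj; exists j => t ltk.
by rewrite -(nth_window (u 0) j ltk) -eqj rev_window.
Qed.

End Windows.

(** * Counting words through their extensions *)

Section Counting.
Variable A : finType.
Implicit Types (f : seq A -> nat) (k : nat).

Lemma sum_tuple_cons f k :
  \sum_(v : k.+1.-tuple A) f v = \sum_(v : k.-tuple A) \sum_x f (x :: v).
Proof.
rewrite pair_bigA /=.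
rewrite (reindex (fun p : k.-tuple A * A => [tuple of p.2 :: p.1])) //=.
exists (fun t : k.+1.-tuple A => ([tuple of behead t], thead t)).
  by move=> [t x] _; rewrite /= theadE; congr (_, _); apply: val_inj.
by move=> t _; rewrite [RHS]tuple_eta.
Qed.

Lemma sum_tuple_rev f k :
  \sum_(v : k.-tuple A) f v = \sum_(v : k.-tuple A) f (rev v).
Proof.
rewrite (reindex_inj (h := fun v : k.-tuple A => [tuple of rev v])) //=.
by move=> v w /(congr1 val) /= /(can_inj revK) /val_inj.
Qed.

Lemma sum_tuple_rcons f k :
  \sum_(v : k.+1.-tuple A) f v = \sum_(v : k.-tuple A) \sum_x f (rcons v x).
Proof.
rewrite sum_tuple_rev (sum_tuple_cons (fun v => f (rev v))).
rewrite [LHS](sum_tuple_rev (fun v => \sum_x f (rev (x :: v)))).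
by apply: eq_bigr => v _; apply: eq_bigr => x _; rewrite rev_cons revK.
Qed.

(** Complexities become sums of truth values over all words of a given length,
    which can be regrouped by middle factor. *)
Lemma complexityE (u : nat -> A) k :
  complexity u k = \sum_(v : k.-tuple A) lang u v.
Proof.
rewrite /complexity cardsE -sum1_card [LHS]big_mkcond /=.
by apply: eq_bigr => v _; rewrite unfold_in -/(lang u v); case: (lang u v).
Qed.

Lemma pal_complexityE (u : nat -> A) k :
  pal_complexity u k = \sum_(v : k.-tuple A) (lang u v && palindrome v).
Proof.
rewrite /pal_complexity cardsE -sum1_card [LHS]big_mkcond /=.
by apply: eq_bigr => v _; rewrite unfold_in /= -/(lang u v); case: (_ && _).
Qed.

Lemma enum_words (P : pred (seq A)) k :
  exists s, [/\ uniq s, forall v, (v \in s) = (size v == k) && P v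
              & size s = \sum_(v : k.-tuple A) P v].
Proof.
exists [seq val t | t : k.-tuple A in [pred t : k.-tuple A | P t]]; split.
- by rewrite map_inj_uniq ?enum_uniq //; apply: val_inj.
- move=> v; apply/imageP/andP => [[t Pt ->] | [szv Pv]].
    by rewrite size_tuple eqxx.
  by exists (Tuple szv).
- rewrite size_image -sum1_card big_mkcond /=.
  by apply: eq_bigr => v _; rewrite inE; case: (P v).
Qed.

Lemma sum_words_le (P : pred (seq A)) k (s : seq (seq A)) :
    (forall v, size v = k -> P v -> v \in s) ->
  \sum_(v : k.-tuple A) P v <= size s.
Proof.
move=> Ps; have [r [r_uniq rP <-]] := enum_words P k.
by apply: uniq_leq_size => // v; rewrite rP => /andP[/eqP]; apply: Ps.
Qed.

Lemma sum_words_ge (P : pred (seq A)) k (s : seq (seq A)) : uniq s ->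
    (forall v, v \in s -> size v = k /\ P v) ->
  size s <= \sum_(v : k.-tuple A) P v.
Proof.
move=> s_uniq sP; have [r [_ rP <-]] := enum_words P k.
by apply: uniq_leq_size => // v /sP[/eqP szv Pv]; rewrite rP szv.
Qed.

Lemma sum_bool_card (T : finType) (P : pred T) :
  \sum_x (P x : nat) = #|[set x | P x]|.
Proof.
by rewrite -sum1dep_card [RHS]big_mkcond; apply: eq_bigr => x _; case: (P x).
Qed.

Lemma sum_bool_eq1 (T : finType) (P : pred T) :
  \sum_x (P x : nat) = 1 -> exists x0 : T, P =1 pred1 x0.
Proof.
move/eqP/sum_nat_eq1 => -[x0 [_ Px0 Pne]]; exists x0 => x /=.
case: eqVneq => [->|nx]; first by case: (P x0) Px0.
by have := Pne x nx isT; case: (P x).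
Qed.

Lemma sum_bool_eq2 (T : finType) (P : pred T) :
  \sum_x (P x : nat) = 2 -> exists x0 x1 : T, x0 != x1 /\ P =1 pred2 x0 x1.
Proof.
rewrite sum_bool_card => /eqP/cards2P[x0 [x1 [ne01 eqP01]]].
by exists x0, x1; split=> // x; have /setP/(_ x) := eqP01; rewrite !inE.
Qed.

End Counting.

(** * Extensions of a factor *)

Section Extensions.
Variables (A : finType) (u : nat -> A).
Hypothesis u_rev : closed_under_reversal u.
Implicit Types (v : seq A) (x y : A).
Local Notation lang := (lang u).

Definition rdeg v := \sum_y lang (rcons v y).
Definition ldeg v := \sum_x lang (x :: v).
Definition bdeg v := \sum_x \sum_y lang (x :: rcons v y).
Definition pdeg v := \sum_x lang (x :: rcons v x).

Lemma lang_rev_cons x v : lang (x :: rev v) = lang (rcons v x).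
Proof. by rewrite -rev_rcons lang_rev. Qed.

Lemma lang_rev_both x v y : lang (y :: rcons (rev v) x) = lang (x :: rcons v y).
Proof. by rewrite -[RHS](lang_rev u_rev) rev_cons rev_rcons. Qed.

Lemma ldeg_rev v : ldeg (rev v) = rdeg v.
Proof. by apply: eq_bigr => x _; rewrite lang_rev_cons. Qed.

Lemma rdeg_ge v : lang v <= rdeg v.
Proof.
case: (boolP (lang v)) => //= /lang_extend[y vy].
by rewrite /rdeg (bigD1 y) //= vy.
Qed.

Lemma rdeg_eq0 v : ~~ lang v -> rdeg v = 0.
Proof.
move=> nlv; apply: big1 => x _; apply/eqP; rewrite eqb0.
by apply: contra nlv => /lang_belast.
Qed.

Lemma rdeg_cat s v : rdeg (s ++ v) <= rdeg v.
Proof.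
apply: leq_sum => y _; rewrite rcons_cat.
elim: s => //= x s; apply: leq_trans.
by case: (boolP (lang (x :: _))) => // /lang_behead ->.
Qed.

Lemma rdeg_gt1P v : reflect
  (exists x y, [/\ lang (rcons v x), lang (rcons v y) & x != y]) (1 < rdeg v).
Proof.
rewrite /rdeg sum_bool_card.
apply: (iffP card_gt1P) => -[x [y [vx vy xy]]]; exists x, y => //.
  by rewrite !inE in vx vy.
by rewrite !inE.
Qed.

Lemma bdeg_rdeg1 v : rdeg v = 1 -> bdeg v = ldeg v.
Proof.
case/sum_bool_eq1 => y0 vy; apply: eq_bigr => x _.
rewrite (bigD1 y0) //= big1 => [|y ny]; last first.
  apply/eqP; rewrite eqb0; apply/negP => /lang_behead.
  by rewrite vy /= (negPf ny).
rewrite addn0; congr nat_of_bool; apply/idP/idP.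
  by rewrite -rcons_cons => /lang_belast.
move/lang_extend => [y]; rewrite rcons_cons => xvy.
by have := lang_behead xvy; rewrite vy => /eqP <-.
Qed.

Lemma bdeg_rev v : bdeg (rev v) = bdeg v.
Proof.
rewrite /bdeg exchange_big /=.
by apply: eq_bigr => x _; apply: eq_bigr => y _; rewrite lang_rev_both.
Qed.

Lemma bdeg_ldeg1 v : ldeg v = 1 -> bdeg v = rdeg v.
Proof.
move=> v1; rewrite -bdeg_rev -ldeg_rev; apply: bdeg_rdeg1.
by rewrite -ldeg_rev revK.
Qed.

Lemma pdeg_rdeg1 v : palindrome v -> rdeg v = 1 -> pdeg v = 1.
Proof.
move=> /eqP pal_v v1; have [y0 vy] := sum_bool_eq1 v1.
have xv x : lang (x :: v) = (x == y0) by rewrite pal_v lang_rev_cons vy.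
rewrite /pdeg (bigD1 y0) //= big1 ?addn0 => [|x nx].
  have /lang_extend[y yv] : lang (y0 :: v) by rewrite xv.
  have := yv; rewrite rcons_cons => /lang_behead; rewrite vy => /eqP eqy.
  by move: yv; rewrite eqy rcons_cons => ->.
apply/eqP; rewrite eqb0; apply/negP => /lang_behead.
by rewrite vy /= (negPf nx).
Qed.

(** The bispecial factors whose contribution to the gap vanishes: the bilateral
    multiplicity bdeg - ldeg - rdeg + 1 equals pdeg - 1. *)
Definition balanced_extensions v :=
  [/\ palindrome v, ldeg v = 2, rdeg v = 2 & bdeg v = pdeg v + 2].

(** A factor that is special on one side at most always satisfies the identity:
    its two-sided extensions correspond to the extensions on its branching side,
    and a palindrome that does not branch on one side does not branch on the
    other either, so its only two-sided extension is a palindrome. *)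
Lemma extension_identity v :
    (1 < rdeg v -> 1 < ldeg v -> balanced_extensions v) ->
  bdeg v + lang v + (lang v && palindrome v)
    = ldeg v + rdeg v + palindrome v * pdeg v.
Proof.
move=> bal; case: (boolP (lang v)) => lv; last first.
  have r0 := rdeg_eq0 lv.
  have l0 : ldeg v = 0 by rewrite -[v]revK ldeg_rev rdeg_eq0 ?lang_rev.
  have b0 : bdeg v = 0.
    apply: big1 => x _; apply: big1 => y _; apply/eqP; rewrite eqb0.
    by apply: contra lv => /lang_behead /lang_belast.
  have p0 : pdeg v = 0.
    apply: big1 => x _; apply/eqP; rewrite eqb0.
    by apply: contra lv => /lang_behead /lang_belast.
  by rewrite l0 r0 b0 p0 muln0.
have r_ge1 : 0 < rdeg v by have := rdeg_ge v; rewrite lv.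
have l_ge1 : 0 < ldeg v.
  by have := rdeg_ge (rev v); rewrite lang_rev // lv -ldeg_rev revK.
have [r1|r_gt1] : rdeg v = 1 \/ 1 < rdeg v by lia.
  rewrite (bdeg_rdeg1 r1) r1; case: (boolP (palindrome v)) => [pal_v|_] /=.
    rewrite (pdeg_rdeg1 pal_v r1); lia.
  lia.
have [l1|l_gt1] : ldeg v = 1 \/ 1 < ldeg v by lia.
  rewrite (bdeg_ldeg1 l1) l1; case: (boolP (palindrome v)) => [/eqP pal_v|_] /=.
    by move: r_gt1; rewrite -ldeg_rev -pal_v l1.
  lia.
have [-> -> -> ->] := bal r_gt1 l_gt1; lia.
Qed.

Lemma palindrome_cons_rcons x v y :
  palindrome (x :: rcons v y) = (x == y) && palindrome v.
Proof.
rewrite /palindrome rev_cons rev_rcons rcons_cons eqseq_cons.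
by case: eqVneq => //= ->; rewrite eqseq_rcons eqxx andbT.
Qed.

Lemma complexity_rdeg k : complexity u k.+1 = \sum_(v : k.-tuple A) rdeg v.
Proof. by rewrite complexityE (sum_tuple_rcons (fun v => lang v : nat)). Qed.

Lemma complexity_ldeg k : complexity u k.+1 = \sum_(v : k.-tuple A) ldeg v.
Proof. by rewrite complexityE (sum_tuple_cons (fun v => lang v : nat)). Qed.

Lemma complexity_bdeg k : complexity u k.+2 = \sum_(v : k.-tuple A) bdeg v.
Proof.
rewrite complexityE (sum_tuple_cons (fun v => lang v : nat)).
rewrite (sum_tuple_rcons (fun v => ldeg v)).
by apply: eq_bigr => v _; rewrite /bdeg exchange_big.
Qed.

Lemma pal_complexity_pdeg k :
  pal_complexity u k.+2 = \sum_(v : k.-tuple A) palindrome v * pdeg v.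
Proof.
rewrite pal_complexityE.
rewrite (sum_tuple_cons (fun v => lang v && palindrome v : nat)).
rewrite (sum_tuple_rcons (fun v => \sum_x (lang (x :: v) && palindrome (x :: v)))).
apply: eq_bigr => v _; rewrite /pdeg big_distrr /=; apply: eq_bigr => y _.
rewrite (bigD1 y) //= palindrome_cons_rcons eqxx andTb big1 => [|x nx].
  by rewrite addn0 andbC mulnb.
by rewrite palindrome_cons_rcons (negPf nx) andbF.
Qed.

(** The second difference of the complexity is the sum of bdeg - ldeg - rdeg + 1,
    and the increase of the palindromic complexity over two steps is the sum of
    pdeg - 1 over palindromes; [extension_identity] matches them term by term. *)
Lemma pal_gap_step k :
    (forall v, size v = k -> 1 < rdeg v -> 1 < ldeg v -> balanced_extensions v) ->
  pal_gap u k.+1 = pal_gap u k.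
Proof.
move=> bal.
have : complexity u k.+2 + complexity u k + pal_complexity u k =
       complexity u k.+1 + complexity u k.+1 + pal_complexity u k.+2.
  rewrite complexity_bdeg pal_complexity_pdeg {1}complexity_ldeg complexity_rdeg.
  rewrite complexityE pal_complexityE -!big_split /=.
  by apply: eq_bigr => v _; apply: extension_identity; apply: bal; rewrite size_tuple.
rewrite /pal_gap /delta_complexity; lia.
Qed.

End Extensions.

(** * The bispecial factor where the slope jumps *)

Section Branching.
Variables (A : finType) (u : nat -> A).
Hypothesis u_rev : closed_under_reversal u.
Implicit Types (v w : seq A) (a b x y : A).
Local Notation lang := (lang u).
Local Notation rdeg := (rdeg u).

(** All the branching at length m happens at w, and the letters on its two sides
    are independent of each other. *)
Record full_branching m w a b : Prop := FullBranching {
  fb_size : size w = m;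
  fb_pal : rev w = w;
  fb_neq : a != b;
  fb_only : forall v, size v = m -> 1 < rdeg v -> v = w;
  fb_ext : forall y, lang (rcons w y) = (y == a) || (y == b);
  fb_all : forall x y, lang (rcons w x) -> lang (rcons w y) ->
             lang (x :: rcons w y) }.

Lemma rdeg_le1 v : rdeg v = lang v -> rdeg v <= 1.
Proof. by move->; case: (lang v). Qed.

(** Right special factors of length m + 1 end in w and have two extensions, so
    a slope of 2 forces two letters x, y such that xw and yw are both special.
    Then w is left special, rev w is right special, and uniqueness makes w a
    palindrome; in particular {x, y} = {a, b}. *)
Lemma full_branching_exists m :
    complexity u m.+1 = (complexity u m).+1 ->
    complexity u m.+1 + 2 <= complexity u m.+2 ->
  exists w a b, full_branching m w a b.
Proof.
move=> delta1 delta2.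
have rl v : lang v <= rdeg v := rdeg_ge u v.
have split_rdeg k :
    complexity u k.+1 = complexity u k + \sum_(v : k.-tuple A) (rdeg v - lang v).
  rewrite complexity_rdeg complexityE -big_split /=.
  by apply: eq_bigr => v _; have := rl v; lia.
have : \sum_(v : m.-tuple A) (rdeg v - lang v) = 1.
  by have := split_rdeg m; lia.
move/eqP/sum_nat_eq1 => -[w0 [_ w_deg w_only]].
have only v : size v = m -> v != w0 -> rdeg v <= 1.
  move=> szv vw; apply: rdeg_le1.
  have vw0 : tcast szv (in_tuple v) != w0.
    by apply: contra vw => /eqP <-; rewrite val_tcast.
  by have := w_only _ vw0 isT; rewrite val_tcast /=; have := rl v; lia.
have {w_only}fb_only v : size v = m -> 1 < rdeg v -> v = w0.
  by move=> szv; case: (eqVneq v w0) => // nv; rewrite ltnNge only.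
have [lw rw] : lang w0 /\ rdeg w0 = 2.
  have := rl w0; case: (boolP (lang w0)) => lw; first by lia.
  by have := rdeg_eq0 lw; lia.
have [a [b [ab ext]]] := sum_bool_eq2 rw.
have : 2 <= #|[set x | 1 < rdeg (x :: w0)]|.
  rewrite -sum_bool_card; have := split_rdeg m.+1.
  rewrite (sum_tuple_cons (fun v => rdeg v - lang v)) (bigD1 w0) //=.
  rewrite [X in _ + (_ + X)]big1 => [|v nv]; last first.
    apply: big1 => x _; have := only _ (size_tuple v) nv.
    have /= := rdeg_cat u [:: x] v; have := rl (x :: v).
    case: (boolP (lang (x :: v))) => [_|lxv]; first by lia.
    by rewrite rdeg_eq0.
  suff: \sum_x (rdeg (x :: w0) - lang (x :: w0)) <= \sum_x (1 < rdeg (x :: w0)) by lia.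
  apply: leq_sum => x _; have /= := rdeg_cat u [:: x] w0; have := rl (x :: w0).
  case: (boolP (lang (x :: w0))) => [_|lxv]; first by lia.
  by rewrite rdeg_eq0.
case/card_gt1P=> x [y []]; rewrite !inE => rx ry xy.
have exts z : 1 < rdeg (z :: w0) -> lang (z :: rcons w0 a) /\ lang (z :: rcons w0 b).
  case/rdeg_gt1P=> c [d []]; rewrite !rcons_cons => zc zd cd.
  have := lang_behead zc; have := lang_behead zd; rewrite !ext /=.
  by case/orP=> /eqP dE /orP[]/eqP cE; move: zc zd cd; rewrite cE dE ?eqxx.
have [xa xb] := exts x rx; have [ya yb] := exts y ry.
have left_lang z : 1 < rdeg (z :: w0) -> lang (z :: w0).
  by case/exts; rewrite -rcons_cons => /lang_belast.
have pal : rev w0 = w0.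
  apply: fb_only; first by rewrite size_rev size_tuple.
  apply/rdeg_gt1P; exists x, y.
  by rewrite -!rev_cons !lang_rev // !left_lang.
have left_ext z : lang (z :: w0) = lang (rcons w0 z).
  by rewrite -{1}pal lang_rev_cons.
have letters z : lang (rcons w0 z) -> z = x \/ z = y.
  have := left_lang x rx; have := left_lang y ry; rewrite !left_ext !ext /=.
  by case/orP=> /eqP yE /orP[]/eqP xE /orP[]/eqP ->; move: xy;
     rewrite xE yE ?eqxx //; auto.
exists w0, a, b; split=> //; first exact: size_tuple.
move=> z t /letters[]-> ; rewrite ext => /orP[]/eqP->; by [].
Qed.

End Branching.

(** * Return words to the branching factor *)

Section Returns.
Variables (A : finType) (u : nat -> A).
Hypotheses (u_rev : closed_under_reversal u) (u_rec : recurrent u).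
Variables (m : nat) (w : seq A) (a b : A).
Hypothesis w_fb : full_branching u m w a b.
Implicit Types (v : seq A) (c d : A) (i j p t r L N : nat).
Local Notation lang := (lang u).
Local Notation window := (window u).
Local Notation agree := (agree u).

Definition occ i : bool := window i m == w.
Definition branch c : bool := lang (rcons w c).

Definition next_occ i r : Prop :=
  [/\ 0 < r, occ (i + r) & forall t, 0 < t < r -> ~~ occ (i + t)].

Lemma occ_agree i j : agree i j m -> occ i = occ j.
Proof. by rewrite /occ => /eq_window ->. Qed.

Lemma agree_occ i j : occ i -> occ j -> agree i j m.
Proof. by move=> /eqP wi /eqP wj; apply/eq_window; rewrite wi. Qed.

Lemma branch_occ i : occ i -> branch (u (i + m)).
Proof.
move=> /eqP wi; apply/lang_rconsP; exists i.
by rewrite (fb_size w_fb) wi.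
Qed.

Lemma branchP c : branch c -> exists2 i, occ i & u (i + m) = c.
Proof.
case/lang_rconsP=> i; rewrite (fb_size w_fb) => -[wi <-].
by exists i; rewrite // /occ -wi.
Qed.

Lemma branch2 c d e : branch c -> branch d -> branch e -> c != d -> e = c \/ e = d.
Proof.
rewrite /branch !(fb_ext w_fb).
by case/orP=> /eqP-> /orP[]/eqP-> /orP[]/eqP->; rewrite ?eqxx; auto.
Qed.

(** All positional arguments use the uniqueness of the special factor through
    this lemma: the same m letters followed by different ones can only be w. *)
Lemma occ_special i j : agree i j m -> u (i + m) != u (j + m) -> occ i.
Proof.
move=> ag ne; apply/eqP; apply: (fb_only w_fb); first exact: size_window.
apply/rdeg_gt1P; exists (u (i + m)), (u (j + m)); split=> //.
  by rewrite -rcons_window lang_window.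
by move/eq_window: ag => ->; rewrite -rcons_window lang_window.
Qed.

(** As long as w is not met, no factor of length m branches, so the continuation
    is forced.  The hypothesis has m + 1 letters because the first m may be w. *)
Lemma agree_deterministic i j r : agree i j m.+1 ->
  (forall t, 0 < t < r -> ~~ occ (i + t)) -> agree i j (r + m).
Proof.
move=> ag1; elim: r => [|r IHr] free; first exact: agree_le ag1.
have ag : agree i j (r + m) by apply: IHr => t ltr; apply: free; lia.
rewrite addSn; apply: agreeS => //.
case: r free ag {IHr} => [|r] free ag; first by rewrite !add0n; apply: ag1.
apply/eqP; rewrite !addnA; apply: contraTT (free r.+1 _) => [ne|]; last by lia.
rewrite negbK; apply: occ_special ne.
exact: agree_shift.
Qed.

Lemma next_occ_agree i j r : agree i j m.+1 -> next_occ i r -> next_occ j r.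
Proof.
move=> ag1 [r_gt0 occr free]; have ag := agree_deterministic ag1 free.
have occE t : t <= r -> occ (i + t) = occ (j + t).
  by move=> ler; apply/occ_agree/agree_shift/(agree_le _ ag); lia.
split=> //; first by rewrite -occE.
by move=> t ltr; rewrite -occE ?free //; lia.
Qed.

Lemma next_occ_unique i r r' : next_occ i r -> next_occ i r' -> r = r'.
Proof.
move=> [r0 wr fr] [r0' wr' fr']; case: (ltngtP r r') => // lt.
  by have := fr' r; rewrite wr r0 lt => /(_ isT).
by have := fr r'; rewrite wr' r0' lt => /(_ isT).
Qed.

Lemma next_occ_le i r t : next_occ i r -> 0 < t -> occ (i + t) -> r <= t.
Proof.
move=> [_ _ free] t0 wt; rewrite leqNgt; apply/negP => lt.
by have := free t; rewrite t0 lt wt => /(_ isT).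
Qed.

Lemma next_occ_exists i : occ i -> exists r, next_occ i r.
Proof.
move=> wi; have lw : factor u w.
  by exists i; move/eqP: wi; rewrite /occurs_at (fb_size w_fb).
have ex : exists r, (0 < r) && occ (i + r).
  have [j lt_ij] := u_rec lw i.+1; rewrite /occurs_at (fb_size w_fb) => wj.
  exists (j - i); rewrite subnKC; last exact: ltnW.
  by rewrite subn_gt0 lt_ij; apply/eqP/esym.
case: (ex_minnP ex) => r /andP[r0 wr] r_min; exists r; split=> // t /andP[t0 lt].
by apply/negP => wt; have := r_min t; rewrite t0 wt => /(_ isT); lia.
Qed.

(** For each letter c after w, choose an occurrence pos c of wc and its return
    time ret c.  The window of length ret c + m at pos c represents the loop. *)
Lemma returns_exist : exists pos ret : A -> nat, forall c, branch c ->
  [/\ occ (pos c), u (pos c + m) = c & next_occ (pos c) (ret c)].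
Proof.
have ex c : exists pr : nat * nat, branch c ->
    [/\ occ pr.1, u (pr.1 + m) = c & next_occ pr.1 pr.2].
  case: (boolP (branch c)) => [/branchP[i wi uc]|]; last by exists (0, 0).
  by have [r hr] := next_occ_exists wi; exists (i, r).
have [f fP] := boolp.choice ex.
by exists (fun c => (f c).1), (fun c => (f c).2).
Qed.

Variables pos ret : A -> nat.
Hypothesis retP : forall c, branch c ->
  [/\ occ (pos c), u (pos c + m) = c & next_occ (pos c) (ret c)].

Lemma return_agree i : occ i ->
  agree (pos (u (i + m))) i (ret (u (i + m)) + m).
Proof.
move=> wi; have [wp up [r0 wr free]] := retP (branch_occ wi).
by apply: agree_deterministic free; apply: agreeS; rewrite ?up //; apply: agree_occ.
Qed.

Lemma return_next_occ i : occ i -> next_occ i (ret (u (i + m))).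
Proof.
move=> wi; have [wp up hp] := retP (branch_occ wi).
by apply: next_occ_agree hp; apply: agreeS; rewrite ?up //; apply: agree_occ.
Qed.

(** Every position after an occurrence of w lies on one of the loops: follow the
    returns to w from i until the last one before p. *)
Lemma locate i p : occ i -> i <= p -> exists c t,
  [/\ branch c, t < ret c & agree (pos c + t) p (ret c - t + m)].
Proof.
have [n] := ubnP (p - i); elim: n i => // n IHn i lt_n wi le_ip.
have bc := branch_occ wi; have ag := return_agree wi.
have [r0 wr _] := return_next_occ wi; move: bc ag r0 wr.
set c := u (i + m) => bc ag r0 wr.
have [lt|le] := ltnP (p - i) (ret c); last by apply: (IHn (i + ret c)); lia.
exists c, (p - i); split=> //; rewrite -{2}(subnKC le_ip).
by apply: agree_shift; apply: agree_le ag; lia.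
Qed.

Lemma loop_inner c t : branch c -> 0 < t < ret c -> ~~ occ (pos c + t).
Proof. by case/retP => _ _ [_ _]; apply. Qed.

Lemma next_occ_inner c t : branch c -> t < ret c -> next_occ (pos c + t) (ret c - t).
Proof.
move=> bc lt; have [_ _ [r0 wr free]] := retP bc.
split; first by lia.
  by rewrite -addnA subnKC //; lia.
by move=> s lts; rewrite -addnA free //; lia.
Qed.

(** Equal factors of length m + 1 have the same time left before w, and the
    same future up to there. *)
Lemma loop_meet c t j r : branch c -> t < ret c -> agree (pos c + t) j m.+1 ->
  next_occ j r -> ret c - t = r /\ agree (pos c + t) j (ret c - t + m).
Proof.
move=> bc lt ag hj; have hp := next_occ_inner bc lt; split.
  by apply: next_occ_unique hj; apply: next_occ_agree hp.
by apply: agree_deterministic ag _; case: hp.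
Qed.

Lemma agree_extend i j : agree i j m -> ~~ occ i -> agree i j m.+1.
Proof.
move=> ag nwi; apply: agreeS => //; apply/eqP.
by apply: contraNT nwi; apply: occ_special.
Qed.

Lemma branch_a : branch a. Proof. by rewrite /branch (fb_ext w_fb) eqxx. Qed.
Lemma branch_b : branch b. Proof. by rewrite /branch (fb_ext w_fb) eqxx orbT. Qed.

(** The loops share w and have ret a - 1 and ret b - 1 further vertices, which
    exhaust the factors of length m. *)
Lemma complexity_le_returns : (complexity u m).+1 <= ret a + ret b.
Proof.
have [_ _ [ra0 _ _]] := retP branch_a; have [wa _ _] := retP branch_a.
have [wb _ [rb0 _ _]] := retP branch_b.
(* w is listed once, as the starting vertex of the loop of a *)
pose s := [seq window (pos a + t) m | t <- iota 0 (ret a)] ++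
          [seq window (pos b + t) m | t <- iota 1 (ret b).-1].
suff : complexity u m <= size s by rewrite size_cat !size_map !size_iota; lia.
rewrite complexityE; apply: (sum_words_le (P := lang)) => v szv /asboolP lv.
have [p le_p wv] := u_rec lv (pos a); rewrite /occurs_at szv in wv.
have [c [t [bc lt ag]]] := locate wa le_p.
have {wv}-> : v = window (pos c + t) m.
  by rewrite wv; apply/eq_window/agree_sym/(agree_le _ ag); lia.
move: bc; rewrite /branch (fb_ext w_fb) mem_cat => /orP[]/eqP cE; subst c.
  by apply/orP; left; apply: map_f; rewrite mem_iota.
case: t lt {ag} => [|t] lt.
  apply/orP; left; apply/mapP; exists 0; rewrite ?mem_iota //.
  by rewrite !addn0 (eqP wa) (eqP wb).
by apply/orP; right; apply: map_f; rewrite mem_iota; lia.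
Qed.

Lemma occ_mirror i j : (forall t, t < m -> u (j + t) = u (i + (m - t.+1))) ->
  occ i = occ j.
Proof.
move=> mir; suff -> : occ j = (rev (window i m) == w).
  by rewrite /occ -{2}(fb_pal w_fb) (inj_eq (can_inj revK)).
congr (_ == _); apply: (@eq_from_nth _ a) => [|t].
  by rewrite size_rev !size_window.
by rewrite size_window => lt; rewrite rev_window // nth_window // mir.
Qed.

(** Reflection maps an occurrence of w at offset s to one whose last letter is at
    distance s from the end, since w is a palindrome. *)
Lemma occ_mirror_in i j k s : s + m <= k ->
    (forall t, t < k -> u (j + t) = u (i + (k - t.+1))) ->
  occ (j + s) = occ (i + (k - (s + m))).
Proof.
move=> le mir; symmetry; apply: occ_mirror => t lt.
rewrite -!addnA mir; last by lia.
by congr (u (_ + _)); lia.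
Qed.

Hypothesis small : complexity u m <= 2 * m + 1.

(** The reversal of the loop of c is again a loop, that of a letter d, of the same
    length r.  If d differs from c, the two loops have no inner vertex in common:
    a common vertex would force equal ends, but the last letter of each loop
    before w is the first letter of the other.  Counting vertices gives
    2 r - 1 <= q <= 2 m + 1.  Then the position r - 1 of the last letter of
    both loops either falls inside their common prefix w, or is m, the
    position of their first letter; in both cases c = d. *)
Lemma loop_palindrome c t : branch c -> t < ret c + m ->
  u (pos c + t) = u (pos c + (ret c + m - t.+1)).
Proof.
move=> bc; have [wc uc [r0 wr free]] := retP bc.
set r := ret c in r0 wr free *.
have [j mir] := mirror u_rev (pos c) (r + m).
have wj : occ j.
  by rewrite -[j]addn0 (occ_mirror_in _ mir) ?add0n ?addnK ?leq_addl.
have hj : next_occ j r.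
  split=> //; first by rewrite (occ_mirror_in _ mir) // subnn addn0.
  move=> s lts; rewrite (occ_mirror_in _ mir); last by lia.
  by rewrite free //; lia.
have rE := next_occ_unique hj (return_next_occ wj).
have ag := return_agree wj; have bd := branch_occ wj.
move: rE ag bd; set d := u (j + m) => rE ag bd.
have [wd ud [_ wrd freed]] := retP bd; rewrite -rE in wrd freed ag.
have {mir} mir s : s < r + m -> u (pos d + s) = u (pos c + (r + m - s.+1)).
  by move=> lts; rewrite ag // mir.
have [dc lt|cd] := eqVneq d c; first by rewrite -{1}dc; apply: mir.
exfalso.
have c_last : u (pos c + r.-1) = d.
  have := mir m; rewrite ud => -> ; last by lia.
  by congr (u (_ + _)); lia.
have d_last : u (pos d + r.-1) = c.
  rewrite mir; last by lia.
  by rewrite -[RHS]uc; congr (u (_ + _)); lia.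
(* inner vertices of the two loops differ *)
have apart s s' : 0 < s < r -> 0 < s' < r -> ~ agree (pos c + s) (pos d + s') m.
  move=> lts lts' agm; have ag1 := agree_extend agm (loop_inner bc lts).
  have [] := loop_meet bc _ ag1 (next_occ_inner bd _); rewrite -/r -?rE; try lia.
  move=> ss' /(_ (r - s).-1); rewrite (_ : s' = s); last by lia.
  rewrite -!addnA (_ : s + (r - s).-1 = r.-1); last by lia.
  by rewrite c_last d_last => dc; case/eqP: cd; apply: dc; lia.
(* vertices of one loop differ, having different times left before w *)
have inj e s s' : branch e -> ret e = r -> s < r -> 0 < s' < r ->
    agree (pos e + s) (pos e + s') m -> s = s'.
  move=> be re lts lts' agm; have nw := loop_inner be.
  have := nw s'; rewrite re => /(_ lts') nw'.
  have [] := loop_meet be _ (agree_extend (agree_sym agm) nw') (next_occ_inner be _);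
    rewrite ?re; lia.
suff : r + r.-1 <= complexity u m.
  move=> le_r; case/eqP: cd; rewrite -c_last -[RHS]d_last.
  (* offset r - 1 lies in the common prefix w, or it is m *)
  have [lt_rm|le_mr] := ltnP r.-1 m; first exact: agree_occ.
  have rm : r.-1 = m by lia.
  by move: c_last d_last; rewrite rm uc ud => -> .
pose s := [seq window (pos c + t) m | t <- iota 0 r] ++
          [seq window (pos d + t) m | t <- iota 1 r.-1].
have -> : r + r.-1 = size s by rewrite size_cat !size_map !size_iota.
rewrite complexityE; apply: sum_words_ge; last first.
  by move=> v; rewrite mem_cat => /orP[]/mapP[x _ ->]; rewrite size_window lang_window.
rewrite cat_uniq !map_inj_in_uniq ?iota_uniq; last 2 first.
- move=> x y; rewrite !mem_iota => ltx lty /eq_window; apply: inj => //; lia.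
- move=> x y; rewrite !mem_iota => ltx lty /eq_window agxy.
  have [y0|y0] := posnP y; last by apply: inj agxy => //; lia.
  have [x0|x0] := posnP x; first by rewrite x0.
  by apply/esym; apply: inj (agree_sym agxy) => //; lia.
rewrite andbT /=; apply/hasPn => v /mapP[y]; rewrite mem_iota => lty ->.
apply/negP => /mapP[x]; rewrite mem_iota => ltx /eq_window /agree_sym agxy.
have [x0|x0] := posnP x; last by apply: apart agxy; lia.
have := loop_inner bd (t := y); rewrite -rE -(occ_agree agxy) x0 addn0 wc.
by move=> h; have : false by apply: h; lia.
Qed.

Lemma loop_last c : branch c -> u (pos c + (ret c).-1) = c.
Proof.
move=> bc; have [wc uc [r0 _ _]] := retP bc.
rewrite loop_palindrome //; last by lia.
by rewrite -[RHS]uc; congr (u (_ + _)); lia.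
Qed.

(** * Palindromes at the length of the branching factor *)

(** The middle of the loop of c, viewed as a closed path with ret c edges in the
    graph whose vertices are the factors of length m and whose edges are those of
    length m + 1: a vertex if ret c is even, an edge if it is odd. *)
Definition center c := window (pos c + (ret c)./2) (m + odd (ret c)).

Lemma size_center c : size (center c) = m + odd (ret c).
Proof. exact: size_window. Qed.

Lemma loop_palindromeE c t (d : nat) : branch c -> t + d <= ret c ->
  (window (pos c + t) (m + d) == rev (window (pos c + t) (m + d)))
    = (window (pos c + t) (m + d) == window (pos c + (ret c - d - t)) (m + d)).
Proof.
move=> bc le; congr (_ == _); apply: (@eq_from_nth _ a) => [|s].
  by rewrite size_rev !size_window.
rewrite size_rev size_window => lt; rewrite rev_window // nth_window //.
rewrite -!addnA loop_palindrome //; last by lia.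
by congr (u (_ + _)); lia.
Qed.

(** Reversal sends offset t on the loop to offset ret c - d - t.  Distinct
    offsets carry distinct factors, since these have different times left before
    w; so a palindrome sits at the fixed offset of this reflection. *)
Lemma palindrome_center c t (d : bool) : branch c -> 0 < t + d -> t < ret c ->
  palindrome (window (pos c + t) (m + d)) = (t == (ret c)./2) && (d == odd (ret c)).
Proof.
move=> bc td lt; rewrite /palindrome loop_palindromeE //; last by case: d {td}; lia.
have E := odd_double_half (ret c).
apply/eqP/andP => [/eq_window ag | [/eqP tE /eqP dE]]; last first.
  by congr (window (_ + _) _); rewrite dE tE -{1}E; lia.
have ag1 : agree (pos c + t) (pos c + (ret c - d - t)) m.+1.
  case: d td ag => /= [|td ag]; first by rewrite !addn1.
  rewrite addn0 in ag; apply: agree_extend => //; apply: loop_inner => //.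
  by move: td => /=; lia.
have lt' : ret c - d - t < ret c by lia.
have [eq_t _] := loop_meet bc lt ag1 (next_occ_inner bc lt').
have : odd (ret c) + ((ret c)./2).*2 = t.*2 + d.
  rewrite E; case: d {ag ag1 lt'} eq_t td => /=; lia.
case: d {ag ag1 lt' eq_t td}; case: (odd (ret c)) {E}; split=> //; lia.
Qed.

(** Equal centres would have equal futures up to the end of the loops, so the
    loops would have the same last letter. *)
Lemma centers_distinct : center a != center b.
Proof.
apply/eqP => eqc; have := congr1 size eqc; rewrite !size_center => eq_sz.
have Ea := odd_double_half (ret a); have Eb := odd_double_half (ret b).
have [_ _ [ra0 _ _]] := retP branch_a; have [_ _ [rb0 _ _]] := retP branch_b.
move: eqc; rewrite /center -eq_sz => /eq_window ag.
have lta : (ret a)./2 < ret a by lia.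
have ltb : (ret b)./2 < ret b by lia.
have ag1 : agree (pos a + (ret a)./2) (pos b + (ret b)./2) m.+1.
  move: ag Ea; case: (odd _) => /= ag Ea; first by rewrite addn1 in ag.
  rewrite addn0 in ag; apply: agree_extend => //; apply: loop_inner => //.
    exact: branch_a.
  by lia.
have [eqr] := loop_meet branch_a lta ag1 (next_occ_inner branch_b ltb).
have eq_ret : ret a = ret b by lia.
rewrite -eq_ret => /(_ (ret a - (ret a)./2).-1).
rewrite -!addnA (_ : (ret a)./2 + _ = (ret a).-1); last by lia.
have := loop_last branch_b; rewrite -eq_ret => ->; rewrite (loop_last branch_a) => ab.
by have /eqP := fb_neq w_fb; apply; apply: ab; lia.
Qed.

Lemma center_neq c : branch c -> center c != w.
Proof.
move=> bc; apply/eqP => eqc; have := congr1 size eqc.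
rewrite size_center (fb_size w_fb) => sz.
have E := odd_double_half (ret c); have [_ _ [r0 _ _]] := retP bc.
have : ~~ occ (pos c + (ret c)./2) by apply: loop_inner => //; lia.
by move: eqc; rewrite /center sz /occ => ->; rewrite eqxx.
Qed.

(** The palindromic factors of lengths m and m + 1 are kept in one list: which of
    the two lengths a centre has depends on the parity of its loop, but the total
    does not. *)
Definition short_palindromes := [:: w; center a; center b].

Lemma short_palindromesP v (d : bool) : size v = m + d ->
  (v \in short_palindromes) = lang v && palindrome v.
Proof.
move=> szv; have lang_w : lang w.
  by have := branch_a; rewrite /branch => /lang_belast.
have centerP c : branch c -> lang (center c) && palindrome (center c).
  move=> bc; have [_ _ [r0 _ _]] := retP bc.
  have E := odd_double_half (ret c).
  by rewrite lang_window palindrome_center ?eqxx //; lia.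
apply/idP/andP => [|[lv pal_v]].
  rewrite !inE => /or3P[]/eqP->.
  - by rewrite lang_w /palindrome (fb_pal w_fb) eqxx.
  - exact/andP/centerP/branch_a.
  - exact/andP/centerP/branch_b.
have [wa _ _] := retP branch_a.
have [p le_p wv] := u_rec (asboolW lv) (pos a); rewrite /occurs_at szv in wv.
have [c [t [bc lt ag]]] := locate wa le_p.
have {wv} wv : v = window (pos c + t) (m + d).
  rewrite wv; apply/eq_window/agree_sym/(agree_le _ ag).
  by case: (d); lia.
have [td|td] := posnP (t + d).
  have [t0 d0] : t = 0 /\ d = 0 :> nat by lia.
  by rewrite wv t0 d0 !addn0; case: (retP bc) => /eqP-> _ _; rewrite mem_head.
move: pal_v; rewrite wv palindrome_center // => /andP[/eqP-> /eqP->].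
move: bc; rewrite -/(center c) /branch (fb_ext w_fb) !inE.
by case/orP=> /eqP->; rewrite eqxx ?orbT.
Qed.

Lemma pal_complexity_short : pal_complexity u m + pal_complexity u m.+1 = 3.
Proof.
have s_uniq : uniq short_palindromes.
  rewrite /= !inE negb_or centers_distinct !(eq_sym w).
  by rewrite !center_neq ?branch_a ?branch_b.
have count_d (d : bool) :
    pal_complexity u (m + d) = count (fun v => size v == m + d) short_palindromes.
  rewrite pal_complexityE -size_filter.
  apply/eqP; rewrite eqn_leq.
  rewrite (sum_words_le (P := fun v => lang v && palindrome v)) => [|v szv Pv].
    apply: (sum_words_ge (P := fun v => lang v && palindrome v)).
      exact: filter_uniq.
    by move=> v; rewrite mem_filter => /andP[/eqP szv]; rewrite (short_palindromesP szv).
  by rewrite mem_filter szv eqxx (short_palindromesP szv).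
have := count_d false; have := count_d true; rewrite /= !addn0 !addn1 => -> ->.
rewrite !size_center (fb_size w_fb).
by case: (odd (ret a)); case: (odd (ret b)) => /=; rewrite ?addn0 ?addn1; lia.
Qed.

(** * Bispecial factors shorter than the two loops together *)

Lemma two_branches c d : branch c -> branch d -> c != d ->
  ret c + ret d = ret a + ret b.
Proof.
rewrite /branch !(fb_ext w_fb).
by case/orP=> /eqP-> /orP[]/eqP->; rewrite ?eqxx // addnC.
Qed.

(** A stretch from an occurrence of w to another that is shorter than both loops
    together repeats its first loop, for it cannot contain both. *)
Lemma stretch_first i L : occ i -> occ (i + L) -> 0 < L < ret a + ret b ->
  ret (u (i + m)) <= L /\
  (ret (u (i + m)) < L -> u (i + ret (u (i + m)) + m) = u (i + m)).
Proof.
move=> wi wL /andP[L0 ltL]; have hi := return_next_occ wi; have bc := branch_occ wi.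
have le_L := next_occ_le hi L0 wL; split=> // lt_L.
have [_ wr _] := hi; have hr := return_next_occ wr.
apply/eqP/negPn/negP; rewrite eq_sym => ne.
have := two_branches bc (branch_occ wr) ne.
have := next_occ_le hr (t := L - ret (u (i + m))).
rewrite -addnA subnKC // => /(_ _ wL); lia.
Qed.

(** Induction along the loops: each is determined by the letter after its first
    occurrence of w, and this letter is the same for all of them. *)
Lemma stretch_determined L i j : L < ret a + ret b ->
    occ i -> occ (i + L) -> occ j -> occ (j + L) -> u (i + m) = u (j + m) ->
  agree i j (L + m).
Proof.
elim/ltn_ind: L i j => L IHL i j ltL wi wiL wj wjL eq_ij.
have [->|L0] := posnP L; first by rewrite add0n; apply: agree_occ.
have ltL2 : 0 < L < ret a + ret b by rewrite L0.
have [le_r cont_i] := stretch_first wi wiL ltL2.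
have [_ cont_j] := stretch_first wj wjL ltL2; rewrite -eq_ij in cont_j.
have ag_i := return_agree wi; have ag_j := return_agree wj; rewrite -eq_ij in ag_j.
have ag := agree_trans (agree_sym ag_i) ag_j.
have [r0 wir _] := return_next_occ wi; have [_ wjr _] := return_next_occ wj.
rewrite -eq_ij in wjr; move: le_r cont_i cont_j ag r0 wir wjr {ag_i ag_j}.
set r := ret _ => le_r cont_i cont_j ag r0 wir wjr.
have [lt_r|ge_r] := ltnP r L; last by apply: agree_le ag; lia.
have -> : L + m = r + (L - r + m) by lia.
apply: agree_glue ag _; first by lia.
by apply: IHL; rewrite ?cont_i ?cont_j -?addnA ?subnKC //; lia.
Qed.

Lemma stretch_last L i : 0 < L < ret a + ret b -> occ i -> occ (i + L) ->
  u (i + L.-1) = u (i + m).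
Proof.
elim/ltn_ind: L i => L IHL i ltL wi wiL.
have [le_r cont] := stretch_first wi wiL ltL.
have last_r := loop_last (branch_occ wi); have ag := return_agree wi.
have [r0 wr _] := return_next_occ wi; move: le_r cont last_r ag r0 wr.
set r := ret _ => le_r cont last_r ag r0 wr.
have [lt_r|ge_r] := ltnP r L.
  rewrite -cont // -(IHL (L - r)); try lia.
  - by rewrite -addnA; congr (u (_ + _)); lia.
  - by rewrite -addnA subnKC.
have -> : L = r by lia.
by rewrite -last_r ag //; lia.
Qed.

(** The reversed stretch has the same length and, as the loops are palindromes,
    the same first letter after w. *)
Lemma stretch_palindrome L i : 0 < L < ret a + ret b -> occ i -> occ (i + L) ->
  palindrome (window i (L + m)).
Proof.
move=> ltL wi wiL; have [j mir] := mirror u_rev i (L + m).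
have wj : occ j by rewrite -[j]addn0 (occ_mirror_in _ mir) ?add0n ?addnK ?leq_addl.
have wjL : occ (j + L) by rewrite (occ_mirror_in _ mir) // subnn addn0.
have eq_ij : u (i + m) = u (j + m).
  rewrite mir -?(stretch_last ltL wi wiL); last by lia.
  by congr (u (_ + _)); lia.
have ag := stretch_determined (proj2 (andP ltL)) wi wiL wj wjL eq_ij.
apply/eqP/(@eq_from_nth _ a) => [|t]; first by rewrite size_rev.
by rewrite size_window => lt; rewrite rev_window // nth_window // ag // mir.
Qed.

(** Suppose that a stretch from i to i + L is followed by its own letter c, and
    that another letter follows w at distance N further.  Sliding the stretch
    along the run of the loop of c until the run ends gives a copy preceded by c
    and followed by another letter. *)
Lemma stretch_overlap L N i : 0 < L < ret a + ret b -> occ i -> occ (i + L) ->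
    u (i + L + m) = u (i + m) ->
    occ (i + L + N) -> u (i + L + N + m) != u (i + m) ->
  exists p, [/\ u p = u (i + m), occ p.+1, occ (p.+1 + L),
                u (p.+1 + m) = u (i + m) & u (p.+1 + L + m) != u (i + m)].
Proof.
move=> ltL; elim/ltn_ind: N i => N IHN i wi wiL eqL wN neN.
have [le_r cont] := stretch_first wi wiL ltL.
have last_r := loop_last (branch_occ wi); have ag := return_agree wi.
have [r0 wr _] := return_next_occ wi.
have hL := return_next_occ wiL; rewrite eqL in hL.
move: le_r cont last_r ag r0 wr hL; set r := ret _.
set c := u (i + m) in eqL neN * => le_r cont last_r ag r0 wr hL.
have [_ wLr _] := hL; rewrite addnAC in wLr.
have eq_r : u (i + r + m) = c.
  by have [/cont //|ge_r] := ltnP r L; rewrite (_ : r = L) //; lia.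
have N0 : 0 < N.
  by case: (posnP N) neN => // ->; rewrite addn0 eqL eqxx.
have le_rN := next_occ_le hL N0 wN.
have [eqrL|nerL] := eqVneq (u (i + r + L + m)) c; last first.
  have p1 : (i + r.-1).+1 = i + r by lia.
  exists (i + r.-1); rewrite p1; split=> //.
  by rewrite -last_r ag //; lia.
have eN : i + r + L + (N - r) = i + L + N by lia.
by have := IHN (N - r) _ (i + r); rewrite eN eq_r; apply => //; lia.
Qed.

Lemma sum_branch (f : A -> nat) : (forall c, ~~ branch c -> f c = 0) ->
  \sum_c f c = f a + f b.
Proof.
move=> f0; rewrite (bigD1 a) //= (bigD1 b) /=; last by rewrite eq_sym (fb_neq w_fb).
rewrite big1 ?addn0 // => c /andP[ca cb]; apply: f0.
by rewrite /branch (fb_ext w_fb) negb_or ca.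
Qed.

(** By reversal bva is a factor with avb, so the only two-sided extensions of v
    that may be missing are the palindromic ones. *)
Lemma balanced_of_mixed v : palindrome v ->
    (forall c, lang (rcons v c) -> branch c) -> lang (a :: rcons v b) ->
  balanced_extensions u v.
Proof.
move=> pal_v v_br avb; have revv := esym (eqP pal_v).
have bva : lang (b :: rcons v a) by rewrite -{1}revv lang_rev_both.
have va : lang (rcons v a) by apply: lang_behead bva.
have vb : lang (rcons v b) by apply: lang_behead avb.
have right0 c : ~~ branch c -> (lang (rcons v c) : nat) = 0.
  by move=> nbc; apply/eqP; rewrite eqb0; apply: contra nbc; apply: v_br.
have left_lang c : lang (c :: v) = lang (rcons v c) by rewrite -{1}revv lang_rev_cons.
have both0 c d : ~~ branch c \/ ~~ branch d -> (lang (c :: rcons v d) : nat) = 0.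
  move=> nb; apply/eqP; rewrite eqb0; apply/negP => cvd.
  have vd := lang_behead cvd; move: cvd; rewrite -rcons_cons => /lang_belast.
  by rewrite left_lang => vc; case: nb => /negP; apply; apply: v_br.
have rdeg2 : rdeg u v = 2 by rewrite /rdeg sum_branch // va vb.
split=> //; first by rewrite -[v in ldeg _ v]revv ldeg_rev.
rewrite /pdeg /bdeg !sum_branch ?avb ?bva /=; first by lia.
all: by move=> c nb; try (apply: big1 => d _); apply: both0; auto.
Qed.

Lemma special_suffix L v i : 1 < rdeg u v -> v = window i (L + m) -> occ (i + L).
Proof.
move=> v_sp vE; apply/eqP; apply: (fb_only w_fb); first exact: size_window.
apply: leq_trans v_sp _.
suff -> : v = window i L ++ window (i + L) m by apply: rdeg_cat.
rewrite vE; apply: (@eq_from_nth _ a) => [|t].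
  by rewrite size_cat !size_window.
rewrite size_window => lt; rewrite nth_cat size_window nth_window //.
case: ltnP => ltL; rewrite nth_window //; last by lia.
by rewrite -addnA subnKC.
Qed.

(** Prefix and suffix of length m of a bispecial factor are special, hence equal
    to w, which makes it a stretch; recurrence provides the end of the run needed
    for the mixed extension. *)
Lemma bispecial_balanced v : m <= size v < m + (ret a + ret b) ->
  1 < rdeg u v -> 1 < ldeg u v -> balanced_extensions u v.
Proof.
move=> /andP[le_mv ltv] v_r v_l; pose L := size v - m.
have szv : size v = L + m by rewrite subnK.
have lv : lang v.
  by apply: contraTT v_r => /rdeg_eq0->.
have v_occ : exists2 i, v = window i (L + m) & occ i /\ occ (i + L).
  case/langP: lv => i; rewrite szv => vE; exists i => //.
  split; last exact: special_suffix vE.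
  have [j mir] := mirror u_rev i (L + m).
  have -> : occ i = occ (j + L) by rewrite (occ_mirror_in _ mir) // subnn addn0.
  apply: (@special_suffix _ (rev v)); first by rewrite -(ldeg_rev u_rev) revK.
  apply: (@eq_from_nth _ a) => [|t]; rewrite vE size_rev !size_window // => lt.
  by rewrite rev_window // nth_window // mir.
have v_br c : lang (rcons v c) -> branch c.
  case/lang_rconsP=> i; rewrite szv addnA => -[vE <-].
  by apply: branch_occ; apply: special_suffix vE.
have pal_v : palindrome v.
  have [i vE [wi wiL]] := v_occ; have [L0|L0] := posnP L.
    by rewrite vE L0 add0n (eqP wi) /palindrome (fb_pal w_fb).
  by rewrite vE stretch_palindrome //; lia.
have v_both c : branch c -> lang (rcons v c).
  have /rdeg_gt1P[x [y [vx vy xy]]] := v_r => bc.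
  by have [->|->] := branch2 (v_br _ vx) (v_br _ vy) bc xy.
apply: balanced_of_mixed => //.
suff [c [d [bc bd cd cvd]]] : exists c d,
    [/\ branch c, branch d, c != d & lang (c :: rcons v d)].
  have dvc : lang (d :: rcons v c) by rewrite {1}(eqP pal_v) lang_rev_both.
  move: bc bd cd cvd dvc; rewrite /branch !(fb_ext w_fb).
  by case/orP=> /eqP-> /orP[]/eqP->; rewrite ?eqxx.
have [i0 vE0 [wi0 wiL0]] := v_occ; have [L0|L0] := posnP L.
  exists a, b; split; rewrite ?branch_a ?branch_b ?(fb_neq w_fb) //.
  rewrite vE0 L0 add0n (eqP wi0); apply: (fb_all w_fb); [exact: branch_a|exact: branch_b].
have ltL : 0 < L < ret a + ret b by lia.
have := v_both _ (branch_occ wi0); case/lang_rconsP=> i; rewrite szv => -[vE uiL].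
have wiL : occ (i + L) by apply: special_suffix vE.
have ag : agree i i0 (L + m) by apply/eq_window; rewrite -vE -vE0.
have wi : occ i by rewrite (occ_agree (agree_le _ ag)) //; lia.
have uim : u (i + m) = u (i0 + m) by apply: ag; lia.
set c := u (i0 + m) in uiL uim.
have [d bd cd] : exists2 d, branch d & d != c.
  have := branch_occ wi0; rewrite -/c {1}/branch (fb_ext w_fb) => /orP[]/eqP->.
    by exists b; rewrite ?branch_b // eq_sym (fb_neq w_fb).
  by exists a; rewrite ?branch_a // (fb_neq w_fb).
have [q le_q wdq] := u_rec (asboolW bd) (i + L).
have {wdq} [wq uq] : occ q /\ u (q + m) = d.
  move: wdq; rewrite /occurs_at size_rcons (fb_size w_fb).
  move/esym; rewrite -/(window _ _) rcons_window => /rcons_inj[wq uq].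
  by split=> //; apply/eqP.
have qE : i + L + (q - (i + L)) = q by lia.
have [|||p [up wp wpL upm upL]] := @stretch_overlap L (q - (i + L)) i ltL wi wiL.
- by rewrite uim -addnA.
- by rewrite qE.
- by rewrite qE uq uim.
exists c, (u (p.+1 + L + m)); split.
- exact: branch_occ.
- exact: branch_occ.
- by rewrite eq_sym -uim.
- have agp : agree p.+1 i (L + m) by apply: stretch_determined => //; lia.
  rewrite vE; move/eq_window: agp => <-; rewrite -addnA -rcons_window.
  by rewrite -uim -up -cons_window lang_window.
Qed.

End Returns.

(** * Range of lengths and conclusion *)

Lemma growth_bound (A : finType) (u : nat -> A) (m n : nat) : m < n ->
    complexity u m.+1 = (complexity u m).+1 ->
    (forall j, m < j < n -> complexity u j + 2 <= complexity u j.+1) ->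
  complexity u m + 2 * (n - m) <= (complexity u n).+1.
Proof.
move=> lt_mn delta_m; rewrite -(subnKC lt_mn); move: (n - m.+1) => k {lt_mn n}.
elim: k => [|k IHk] delta_gt; first by rewrite addn0 delta_m; lia.
have : forall j, m < j < m.+1 + k -> complexity u j + 2 <= complexity u j.+1.
  by move=> j ltj; apply: delta_gt; lia.
by move/IHk; have := delta_gt (m.+1 + k); rewrite addnS; lia.
Qed.

(** Writing E for 2 m + 2 - q, which is positive, the two bounds on p combine into
    n E <= (m + 1 + q) E. *)
Lemma length_bound (m n q p : nat) : q <= 2 * m + 1 -> m < n ->
    q + 2 * (n - m) <= p.+1 ->
    (p%:R <= slope_bound m q * n%:R + 1 :> rat)%R ->
  n <= m + 1 + q.
Proof.
move=> le_q lt_mn le_p; rewrite /slope_bound mulrAC -natrM -lerBlDr.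
rewrite ler_pdivlMr ?ltr0n; last by lia.
have p_gt0 : 0 < p by lia.
rewrite -[p]prednK // -natr1 addrK -natrM ler_nat => le_pn.
(* this lower bound for p, used in le_pn, leaves n E <= (m + 1 + q) E *)
have le_p' : q + 2 * n <= p.-1 + (2 + 2 * m) by lia.
by nia.
Qed.

Local Open Scope ring_scope.

Theorem theorem3p4 (A : finType) (u : nat -> A)
  (u_rec : recurrent u) (u_aper : aperiodic u)
  (u_rev : closed_under_reversal u)
  (m n : nat) (lt_mn : (m < n)%N)
  (delta_m : delta_complexity u m = 1)
  (delta_gt_m : forall j : nat, (m < j <= n)%N -> 2 <= delta_complexity u j)
  (le_pm : (complexity u m <= 2 * m + 1)%N)
  (le_pn : (complexity u n)%:R
             <= slope_bound m (complexity u m) * n%:R + 1 :> rat) :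
  pal_gap u n = 0.
Proof.
have step_m : complexity u m.+1 = (complexity u m).+1.
  by move: delta_m; rewrite /delta_complexity; lia.
have step_gt j : (m < j <= n)%N -> (complexity u j + 2 <= complexity u j.+1)%N.
  by move=> /delta_gt_m; rewrite /delta_complexity; lia.
have le_n : (n <= m + 1 + complexity u m)%N.
  apply: length_bound le_pn => //; apply: growth_bound => // j ltj.
  by apply: step_gt; lia.
have [w [a [b w_fb]]] : exists w a b, full_branching u m w a b.
  by apply: full_branching_exists => //; apply: step_gt; lia.
have [pos [ret retP]] := returns_exist u_rec w_fb.
have le_ret := complexity_le_returns u_rec w_fb retP.
have gap_m : pal_gap u m = 0.
  have := pal_complexity_short u_rev u_rec w_fb retP le_pm.
  by rewrite /pal_gap delta_m; lia.
suff gap k : (m + k <= n)%N -> pal_gap u (m + k) = 0.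
  by rewrite -(subnKC (ltnW lt_mn)) gap // subnKC // ltnW.
elim: k => [|k IHk] le_k; first by rewrite addn0.
rewrite addnS pal_gap_step ?IHk //; first by lia.
move=> v szv; apply: (bispecial_balanced u_rev u_rec w_fb retP le_pm).
by rewrite szv; lia.
Qed.
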